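(* Fix a total transmit power $P>0$ and a normalized cache size $m\in(0,1)$. Consider content delivery to $K$ single-antenna users from an $n_{\mathrm t}$-antenna base station over i.i.d. Rayleigh fading, with no channel state information at the transmitter and with coded caching over wireless multicasting. Linear scaling of the equivalent content delivery rate with respect to $K$ is achieved in each of the following cases. (1) Let $n_{\mathrm t}=n_{\mathrm t}(K)\ge 1$ and $L=L(K)\ge 1$ be integers such that $L\,n_{\mathrm t}\ge \ln(K)+O(1)$ as $K\to\infty$. Then, with $T(m,K)$ being either the centralized or the decentralized expression, the content delivery rate $$\mathcal R_{\mathrm{mul}}=\frac{K}{T(m,K)}\,\mathbb E\Big[\min_{k\in[K]}\frac1L\sum_{l=1}^{L}\ln\Big(1+\frac{P}{n_{\mathrm t}}\|\mathbf H_{k,l}\|^2\Big)\Big]$$ satisfies $\mathcal R_{\mathrm{mul}}=\Omega(K)$ as $K\to\infty$. (2) Let $L=1$ (quasi-static fading) and let $n_{\mathrm t}\ge 1$ be an arbitrary number of transmit antennas. Then there is an SNR threshold $s>0$ such that the content delivery rate of the threshold-based user selection scheme with one-bit feedback, $$\mathcal R_{\mathrm{mul}}(s)=\mathbb E\Big[\frac{\frac{m}{1-m}\,\mathrm K^*(s)}{1-(1-m)^{\mathrm K^*(s)}}\,\ln(1+s)\Big],\qquad \mathrm K^*(s)=\big|\{k\in[K]:\mathsf{SNR}_k\ge s\}\big|,$$ satisfies $\mathcal R_{\mathrm{mul}}(s)=\Omega(K)$ as $K\to\infty$.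
   Context: $[K]=\{1,\dots,K\}$. The vectors $\mathbf H_{k,l}\in\mathbb C^{n_{\mathrm t}}$ ($k\in[K]$ the user, $l\in[L]$ the sub-channel) are i.i.d. circularly symmetric complex Gaussian $\mathcal{CN}(0,\mathrm I_{n_{\mathrm t}})$. For $L=1$ write $\mathbf H_k=\mathbf H_{k,1}$ and $\mathsf{SNR}_k=\frac{P}{n_{\mathrm t}}\|\mathbf H_k\|^2$. The number of multicast transmissions (normalized by the file size) needed by coded caching to serve $K$ users is $T(m,K)=(1-m)\frac{1}{1/K+m}$ for centralized caching and $T(m,K)=(1-m)\frac{1-(1-m)^K}{m}$ for decentralized caching. The equivalent content delivery rate is $\frac{K}{T(m,K)}$ times the average multicast rate (in nats). The system has linear scaling (is scalable) if the content delivery rate grows at least linearly with $K$, i.e. is $\Omega(K)$. In case (2) each user reports with one bit whether its SNR is at least $s$. The base station serves only the $\mathrm K^*(s)$ users that report yes, multicasting at rate $\ln(1+s)$ with decentralized coded caching. The expression inside the expectation is taken to be $0$ when $\mathrm K^*(s)=0$. The condition $L n_{\mathrm t}\ge\ln(K)+O(1)$ means: there is a real constant $c_0$ with $L n_{\mathrm t}\ge \ln K+c_0$ for all sufficiently large $K$. $f(K)=\Omega(g(K))$ means there is $c>0$ with $|g(K)|\le c|f(K)|$ for all sufficiently large $K$. *)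

(* Defs.v *)
From HB Require Import structures.
From mathcomp Require Import all_boot all_order all_algebra.
From mathcomp Require Import all_classical all_reals all_analysis.
From mathcomp Require Export complex.

Set Implicit Arguments.
Unset Strict Implicit.
Unset Printing Implicit Defensive.

Import Order.TTheory GRing.Theory Num.Theory.
Import numFieldNormedType.Exports.

Local Open Scope classical_set_scope.
Local Open Scope ring_scope.

(* Independence of the families of events [S i], i : I; random vectors are
   independent when the sigma-algebras they generate are. *)
Definition mutually_independent (R : realType) (d : measure_display)
    (T : measurableType d) (Pr : probability T R) (I : finType)
    (S : I -> set (set T)) : Prop :=
  forall (J : {set I}) (A : I -> set T),
    (forall i, i \in J -> S i (A i)) ->
    Pr (\bigcap_(i in [set` J]) A i) = (\prod_(i in J) Pr (A i))%E.

(* The 2n real coordinates of a vector of C^n. *)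
Definition rcoord (R : realType) (n : nat) (j : 'I_n * bool)
    (v : 'rV[R[i]]_n) : R :=
  if j.2 then complex.Im (v ord0 j.1) else complex.Re (v ord0 j.1).

(* Borel sigma-algebra of C^n. *)
Definition cvec_borel (R : realType) (n : nat) : set (set 'rV[R[i]]_n) :=
  <<s \bigcup_j preimage_set_system setT (@rcoord R n j) measurable >>.

(* X ~ CN(0, I_n): the real and imaginary parts of the n entries are 2n
   independent real Gaussians N(0, 1/2).  The second argument of [normal_prob]
   is the standard deviation. *)
Definition std_complex_gaussian (R : realType) (d : measure_display)
    (T : measurableType d) (Pr : probability T R) (n : nat)
    (X : T -> 'rV[R[i]]_n) : Prop :=
  [/\ (forall A, @cvec_borel R n A -> measurable (X @^-1` A)),
      mutually_independent Pr (fun j : 'I_n * bool =>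
        preimage_set_system setT (rcoord j \o X) measurable)
    & forall (j : 'I_n * bool) (B : set R), measurable B ->
        Pr ((rcoord j \o X) @^-1` B) = normal_prob 0 (Num.sqrt 2^-1) B].

(* The channel vectors H k l (user k, sub-channel l) are i.i.d. CN(0, I_n). *)
Definition iid_rayleigh (R : realType) (d : measure_display)
    (T : measurableType d) (Pr : probability T R) (K L n : nat)
    (H : 'I_K -> 'I_L -> T -> 'rV[R[i]]_n) : Prop :=
  (forall k l, std_complex_gaussian Pr (H k l)) /\
  mutually_independent Pr (fun kl : 'I_K * 'I_L =>
    preimage_set_system setT (H kl.1 kl.2) (@cvec_borel R n)).

(* Squared Euclidean norm: the library norm on row vectors is the sup norm. *)
Definition norm2sq (R : realType) (n : nat) (h : 'rV[R[i]]_n) : R :=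
  \sum_(j < n) Normc.normc (h ord0 j) ^+ 2.

Definition snr (R : realType) (P : R) (n : nat) (h : 'rV[R[i]]_n) : R :=
  P / n%:R * norm2sq h.

Definition T_centralized (R : realType) (m : R) (K : nat) : R :=
  (1 - m) * (1 / (1 / K%:R + m)).

Definition T_decentralized (R : realType) (m : R) (K : nat) : R :=
  (1 - m) * ((1 - (1 - m) ^+ K) / m).

(* Minimum over a nonempty [K]; the value 0 for K = 0 is a junk value. *)
Definition min_user (R : realType) (K : nat) (f : 'I_K -> R) : R :=
  let s := codom f in \big[Num.min/head 0 s]_(x <- s) x.

(* [t] is the number of transmissions T(m, K); [fine] only forgets that the
   expectation is typed in the extended reals, and is 0 on infinite values. *)
Definition multicast_rate (R : realType) (P t : R) (d : measure_display)
    (T : measurableType d) (Pr : probability T R) (K L n : nat)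
    (H : 'I_K -> 'I_L -> T -> 'rV[R[i]]_n) : R :=
  K%:R / t *
  fine 'E_Pr[(fun w => min_user (fun k =>
    1 / L%:R * \sum_(l < L) ln (1 + snr P (H k l w))))%R]%E.

Definition nb_selected (R : realType) (P s : R) (d : measure_display)
    (T : measurableType d) (K n : nat)
    (H : 'I_K -> T -> 'rV[R[i]]_n) (w : T) : nat :=
  #|[pred k : 'I_K | s <= snr P (H k w)]|.

Definition selection_rate (R : realType) (P m s : R) (d : measure_display)
    (T : measurableType d) (Pr : probability T R) (K n : nat)
    (H : 'I_K -> T -> 'rV[R[i]]_n) : R :=
  fine 'E_Pr[(fun w =>
    let Ks := nb_selected P s H w in
    if Ks == 0%N then 0
    else m / (1 - m) * Ks%:R / (1 - (1 - m) ^+ Ks) * ln (1 + s))%R]%E.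

Definition linear_scaling (R : realType) (f : nat -> R) : Prop :=
  (f : nat -> R^o) =Omega_\oo (fun K => K%:R : R^o).

(* Main.v *)
Require Import Defs.
From HB Require Import structures.
From mathcomp Require Import all_boot all_order all_algebra.
From mathcomp Require Import all_classical all_reals all_analysis.
From mathcomp Require Import complex.
From mathcomp Require Import measurable_realfun zify ring lra.

Set Implicit Arguments.
Unset Strict Implicit.
Unset Printing Implicit Defensive.

Import Order.TTheory GRing.Theory Num.Theory.
Import numFieldNormedType.Exports.

Local Open Scope classical_set_scope.
Local Open Scope ring_scope.

(* Everything reduces to one counting estimate: among independent events of
   probability at most q, the probability that at least N of them occur is at
   most 2^(number of events) q^N.  Let q be the probability that a real Gaussian
   coordinate has square < eta; it tends to 0 with eta.  If |H|^2 < n eta, then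
   at least n of the 2n coordinates have square < eta, so this happens with
   probability at most (4q)^n.  If the rate of a user is below
   ln(1 + P eta) / 2, then at least half of the L sub-channels satisfy
   |H|^2 < n eta, which happens with probability at most (16q)^(nL/2).  For
   16q <= e^-4 and L n >= ln K + c0, a union bound over the K users leaves
   probability O(1/K), so the expected minimum rate is bounded below.  For user
   selection, the threshold s = P eta with q = 1/8 is reached by each user with
   probability at least 1/2, and the integrand is at least
   m/(1-m) ln(1+s) K*(s).  Upper bounds on the expectations are also needed,
   because [fine] sends +oo to 0. *)

Lemma linear_scaling_ge (R : realType) (f : nat -> R) (c : R) :
  0 < c -> (\forall K \near \oo, c * K%:R <= f K) -> linear_scaling f.
Proof.
move=> c0 cf; rewrite /linear_scaling eqOmegaE qualifE; apply/asboolP.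
exists c => //; near=> K.
have cK : c * K%:R <= f K by near: K.
by rewrite ger0_norm// ger0_norm// (le_trans _ cK)// mulr_ge0// ltW.
Unshelve. all: by end_near. Qed.

(** * Union bounds for finite families of events *)

Section probability_bounds.
Context {R : realType} {d : measure_display} {T : measurableType d}.
Variable Pr : probability T R.

Lemma measurable_bigsetU_fin (I : finType) (P : pred I) (B : I -> set T) :
  (forall i, P i -> measurable (B i)) ->
  measurable (\big[setU/set0]_(i | P i) B i).
Proof. by move=> mB; apply: big_ind => //; exact: measurableU. Qed.

Lemma probability_bigsetU_le (I : finType) (P : pred I) (B : I -> set T) :
  (forall i, P i -> measurable (B i)) ->
  (Pr (\big[setU/set0]_(i | P i) B i) <= \sum_(i | P i) Pr (B i))%E.
Proof.
move=> mB.
(* Measurability is carried along in the induction, since subadditivity of two sets requires it. *)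
suff [] : measurable (\big[setU/set0]_(i | P i) B i) /\
  (Pr (\big[setU/set0]_(i | P i) B i) <= \sum_(i | P i) Pr (B i))%E by [].
apply: (big_ind2 (fun A x => measurable A /\ (Pr A <= x)%E)).
- by rewrite measure0.
- move=> A x B' y [mA Ax] [mB' By]; split; first exact: measurableU.
  by rewrite (le_trans (measureU2 _ _ _))// leeD.
- by move=> i Pi; split => //; exact: mB.
Qed.

(** Take for [B] the union, over index sets [J] with at least [N] elements, of the intersections of
    the [E i] for [i] in [J]. Independence bounds each intersection by [q ^+ N], and there are at
    most [2 ^+ #|I|] of them. Bounding a measurable superset avoids showing that the counting event
    itself is measurable. *)
Lemma probability_many_le (I : finType) (S : I -> set (set T)) (E : I -> set T)
    (q : R) (N : nat) :
  mutually_independent Pr S -> (forall i, S i (E i)) ->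
  (forall i, measurable (E i)) -> (forall i, Pr (E i) <= q%:E)%E ->
  0 <= q -> q <= 1 ->
  exists B : set T, [/\ measurable B,
    (forall w, (N <= #|[pred i | w \in E i]|)%N -> B w) &
    (Pr B <= (2 ^+ #|I| * q ^+ N)%:E)%E].
Proof.
move=> ind SE mE Eq q0 q1.
pose C (J : {set I}) := \bigcap_(i in [set` J]) E i.
have mC J : measurable (C J).
  by apply: fin_bigcap_measurable => //; exact: finite_finset.
exists (\big[setU/set0]_(J : {set I} | (N <= #|J|)%N) C J); split.
- exact: measurable_bigsetU_fin.
- move=> w wN; set J := [set i | w \in E i]%SET.
  rewrite (bigD1 J)/=; last by rewrite /J cardsE.
  by left => i; rewrite /= /J inE => /set_mem.
- apply: (le_trans (probability_bigsetU_le _)) => [J _|]; first exact: mC.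
  apply: (@le_trans _ _ (\sum_(J : {set I} | (N <= #|J|)%N) (q ^+ N)%:E)%E).
    apply: lee_sum => J NJ; rewrite ind//.
    rewrite (eq_bigr (fun i => (fine (Pr (E i)))%:E)); last first.
      by move=> i _; rewrite fineK// fin_num_measure.
    rewrite prodEFin lee_fin (@le_trans _ _ (\prod_(i in J) q))//.
      apply: ler_prod => i _; rewrite fine_ge0//=.
      by rewrite -lee_fin fineK// fin_num_measure.
    by rewrite prodr_const ler_wiXn2l.
  rewrite sumEFin lee_fin sumr_const -[leLHS]mulr_natl.
  rewrite ler_wpM2r ?exprn_ge0// -natrX ler_nat -[X in (2 ^ X)%N]cardsT -card_powerset powersetT.
  by rewrite cardsT max_card.
Qed.

End probability_bounds.

(** * Bounds on the minimum over users *)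

Section min_user.
Context {R : realType}.

Lemma min_userE K (f : 'I_K.+1 -> R) :
  min_user f = \big[Num.min/f ord0]_(k < K.+1) f k.
Proof.
rewrite /min_user; have -> : head 0 (codom f) = f ord0.
  by rewrite /codom /image_mem enum_ordSl.
by rewrite /codom /image_mem big_map big_enum.
Qed.

Lemma le_min_user K (f : 'I_K -> R) x :
  (0 < K)%N -> (forall k, x <= f k) -> x <= min_user f.
Proof.
case: K f => // K f _ xf; rewrite min_userE.
by apply: le_bigmin => // k _.
Qed.

Lemma min_user_le K (f : 'I_K -> R) k : min_user f <= f k.
Proof.
case: K f k => [f [//]|K f k].
by rewrite min_userE; exact: bigmin_le.
Qed.

End min_user.

Lemma measurable_sublevel (R : realType) d (T : measurableType d) (f : T -> R)
    (e : R) :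
  measurable_fun setT f -> measurable [set w | f w < e].
Proof.
move=> mf; rewrite (_ : [set w | _] = setT `&` f @^-1` `]-oo, e[%classic).
  exact: mf.
by rewrite setTI; apply/seteqP; split => w /=; rewrite in_itv.
Qed.

(** * Small-ball and second-moment estimates for a real Gaussian *)

Section normal_estimates.
Context {R : realType}.
Variable s : R.
Hypothesis s0 : s != 0.
Local Notation mu := (@lebesgue_measure R).

(** The density is at most its peak, so []-r, r[] has mass at most [2 * r * normal_peak s]; [r] is
    chosen to make this equal to [e]. *)
Lemma normal_prob_sqr_lt_small (e : R) : 0 < e ->
  exists2 eta : R, 0 < eta & (normal_prob 0 s [set x : R | (x ^+ 2 < eta)%R] <= e%:E)%E.
Proof.
move=> e0; have p0 := normal_peak_gt0 s0.
pose r := e / (2 * normal_peak s).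
have r0 : 0 < r by rewrite divr_gt0// mulr_gt0.
exists (r ^+ 2); first exact: exprn_gt0.
have rE : [set x : R | x ^+ 2 < r ^+ 2] = `]-r, r[%classic.
  apply/seteqP; split => x /=; rewrite in_itv/= -ltr_norml.
    by rewrite -real_normK ?num_real// ltr_pXn2r ?nnegrE// ltW.
  by move=> xr; rewrite -real_normK ?num_real// ltr_pXn2r ?nnegrE// ltW.
rewrite rE /normal_prob.
have pdf_ub : (\int[mu]_(x in `](- r)%R, r[%classic) (normal_pdf 0 s x)%:E <=
    \int[mu]_(x in `](- r)%R, r[%classic) (normal_peak s)%:E)%E.
  apply: ge0_le_integral => //=.
  - by move=> x _; rewrite lee_fin normal_pdf_ge0.
  - by apply/measurable_EFinP/measurable_funTS; exact: measurable_normal_pdf.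
  - by move=> x _; rewrite lee_fin normal_pdf_ub.
apply: (le_trans pdf_ub).
rewrite integral_cst//= lebesgue_measure_itv/= lte_fin.
have -> : - r < r by rewrite gtrN.
rewrite -EFinB -EFinM lee_fin opprK /r -mulr2n -mulr_natl.
rewrite le_eqVlt; apply/orP; left; apply/eqP; field.
by rewrite gt_eqF.
Qed.

(** The Radon-Nikodym derivative of [normal_prob 0 s] agrees almost everywhere with the Gaussian
    density, because both have the same integral over every measurable set. *)
Lemma ge0_integral_normal_prob (f : R -> \bar R) : (forall x, 0 <= f x)%E ->
  measurable_fun setT f ->
  (\int[normal_prob 0 s]_x f x = \int[mu]_x (f x * (normal_pdf 0 s x)%:E))%E.
Proof.
move=> f0 mf.
rewrite -(@Radon_Nikodym_SigmaFinite.change_of_variables _ _ R _ mu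
  (normal_prob_dominates 0 s))//.
apply: ae_eq_integral => //.
- apply: emeasurable_funM => //.
  exact: measurable_int (Radon_Nikodym_SigmaFinite.f_integrable
    (normal_prob_dominates 0 s)).
- apply: emeasurable_funM => //.
  by apply/measurable_EFinP; exact: measurable_normal_pdf.
apply: ae_eqe_mul2l; apply: integral_ae_eq => //.
- exact: Radon_Nikodym_SigmaFinite.f_integrable (normal_prob_dominates 0 s).
- by apply/measurable_EFinP; exact: measurable_normal_pdf.
- move=> E _ mE.
  by rewrite -(Radon_Nikodym_SigmaFinite.f_integral (normal_prob_dominates 0 s)).
Qed.

(* [x ^ 2] times the density is dominated by a multiple of the density of
   standard deviation [2 s], because [x ^ 2 <= c * expR (x ^ 2 / c)]. *)
Lemma normal_prob_sqr_lty :
  (\int[normal_prob 0 s]_x (x ^+ 2)%:E < +oo)%E.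
Proof.
have s20 : 2 * s != 0 by rewrite mulf_neq0// pnatr_eq0.
have p0 := normal_peak_gt0 s0; have p20 := normal_peak_gt0 s20.
have ss0 : 0 < s ^+ 2 by rewrite exprn_even_gt0.
rewrite ge0_integral_normal_prob//; first last.
- by apply/measurable_EFinP; exact: measurable_funX.
- by move=> x; rewrite lee_fin sqr_ge0.
pose c := normal_peak s / normal_peak (2 * s) * (4 * s ^+ 2).
have c0 : 0 <= c.
  exact: mulr_ge0 (divr_ge0 (ltW p0) (ltW p20)) (mulr_ge0 (ler0n _ 4) (ltW ss0)).
apply: (@le_lt_trans _ _ (\int[mu]_x (c%:E * (normal_pdf 0 (2 * s) x)%:E))%E).
  apply: ge0_le_integral => //=.
  - by move=> x _; rewrite mule_ge0// lee_fin ?sqr_ge0// normal_pdf_ge0.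
  - apply: emeasurable_funM; apply/measurable_EFinP.
      exact: measurable_funX.
    exact: measurable_normal_pdf.
  - apply: emeasurable_funM => //.
    by apply/measurable_EFinP; exact: measurable_normal_pdf.
  move=> x _; rewrite -!EFinM lee_fin !normal_pdfE// /normal_fun !subr0.
  set y := x ^+ 2 / (4 * s ^+ 2).
  have xE : x ^+ 2 = y * (4 * s ^+ 2) by rewrite /y; field.
  (* In terms of [y] the two exponents are [- 2 * y] and [- y / 2]; their gap [3 / 2 * y] pays for
     the factor [x ^+ 2]. *)
  have -> : expR (- x ^+ 2 / (s ^+ 2 *+ 2)) =
      expR (- x ^+ 2 / ((2 * s) ^+ 2 *+ 2)) * expR (- (3 / 2 * y)).
    by rewrite -expRD; congr expR; rewrite /y; field.
  have y0 : 0 <= y by rewrite mulr_ge0 ?sqr_ge0// invr_ge0 mulr_ge0// ltW.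
  have ye : y * expR (- (3 / 2 * y)) <= 1.
    rewrite expRN ler_pdivrMr ?expR_gt0// mul1r.
    apply: le_trans (expR_ge1Dx _); lra.
  rewrite /c [X in X * _]xE.
  set E := expR _; set F := expR _ in ye *.
  have -> : y * (4 * s ^+ 2) * (normal_peak s * (E * F)) =
    (y * F) * (4 * s ^+ 2 * normal_peak s * E) by ring.
  have -> : normal_peak s / normal_peak (2 * s) * (4 * s ^+ 2) *
    (normal_peak (2 * s) * E) = 1 * (4 * s ^+ 2 * normal_peak s * E).
    by field; rewrite gt_eqF.
  apply: ler_wpM2r ye; apply: mulr_ge0 (expR_ge0 _).
  exact: mulr_ge0 (mulr_ge0 (ler0n _ 4) (ltW ss0)) (ltW p0).
rewrite ge0_integralZl//=.
- by rewrite integral_normal_pdf mule1 ltry.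
- by apply/measurable_EFinP; exact: measurable_normal_pdf.
- by move=> x _; rewrite lee_fin normal_pdf_ge0.
Qed.

End normal_estimates.

(** The integral of a nonnegative function is a supremum over simple functions below it, hence
    monotone without measurability. Thus the rates never have to be shown measurable. *)
Lemma ge0_le_integral_nonmeas (R : realType) (d : measure_display)
    (T : measurableType d) (mu : {measure set T -> \bar R}) (f g : T -> \bar R) :
  (forall x, 0 <= f x)%E -> (forall x, f x <= g x)%E ->
  (\int[mu]_x f x <= \int[mu]_x g x)%E.
Proof.
move=> f0 fg.
have g0 x : (0 <= g x)%E by rewrite (le_trans (f0 x)).
rewrite !ge0_integralTE//; apply: le_ereal_sup => _ /= [h hf <-].
by exists h => // x; rewrite (le_trans (hf x)).
Qed.

(** Markov's inequality for the counting measure. *)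
Lemma card_mul_le_sum (R : realType) (I : finType) (F : I -> R) (t : R) :
  (forall i, 0 <= F i) -> #|[pred i | t <= F i]|%:R * t <= \sum_i F i.
Proof.
move=> F0; rewrite mulr_natl -sumr_const [leRHS](bigID [pred i | t <= F i])/=.
by rewrite -[leLHS]addr0 lerD ?sumr_ge0// ler_sum.
Qed.

(* [g_sigma_algebraType] requires a pointed type, and ['rV[R[i]]_n] has no such
   instance. *)
Definition cvec (R : realType) (n : nat) : Type := 'rV[R[i]]_n.
HB.instance Definition _ (R : realType) (n : nat) := Choice.on (cvec R n).
HB.instance Definition _ (R : realType) (n : nat) :=
  isPointed.Build (cvec R n) (0 : 'rV[R[i]]_n).

(** * Measurability of the squared norm on complex vectors *)

Section complex_vectors.
Context {R : realType} {n : nat}.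

Local Notation cvecT := (g_sigma_algebraType
  (\bigcup_j preimage_set_system setT (@rcoord R n j : cvec R n -> R) measurable)).

Lemma measurable_rcoord j : measurable_fun setT (rcoord j : cvecT -> R).
Proof.
move=> _ Y mY; apply: sub_sigma_algebra; exists j => //.
by exists Y.
Qed.

Lemma norm2sqE (v : 'rV[R[i]]_n) : norm2sq v = \sum_j rcoord j v ^+ 2.
Proof.
rewrite /norm2sq.
rewrite -(pair_bigA _ (fun i b => rcoord (i, b) v ^+ 2))/=.
apply: eq_bigr => i _; rewrite big_bool /rcoord/=.
by case: (v ord0 i) => a b /=; rewrite sqr_sqrtr ?addr_ge0 ?sqr_ge0// addrC.
Qed.

Lemma norm2sq_ge0 (v : 'rV[R[i]]_n) : 0 <= norm2sq v.
Proof. by rewrite norm2sqE sumr_ge0// => j _; exact: sqr_ge0. Qed.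

Lemma measurable_norm2sq : measurable_fun setT (@norm2sq R n : cvecT -> R).
Proof.
rewrite (_ : @norm2sq R n = fun v => \sum_j rcoord j v ^+ 2); last first.
  by apply/funext => v; rewrite norm2sqE.
apply: measurable_sum => j; apply: measurable_funX.
exact: measurable_rcoord.
Qed.

Lemma cvec_borel_norm2sq (e : R) : cvec_borel [set v | @norm2sq R n v < e].
Proof. exact: (measurable_sublevel e measurable_norm2sq). Qed.

End complex_vectors.

(** * Squared norm of a complex Gaussian vector *)

Section gaussian_vector.
Context {R : realType} {d : measure_display} {T : measurableType d}.
Variables (Pr : probability T R) (n : nat) (X : T -> 'rV[R[i]]_n).
Hypothesis hX : std_complex_gaussian Pr X.
Local Notation sigma := (Num.sqrt 2^-1 : R).

Lemma measurable_rcoord_comp j : measurable_fun setT (rcoord j \o X).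
Proof.
have [mX _ _] := hX; move=> _ Y mY; rewrite setTI comp_preimage.
apply: mX; have := measurable_rcoord j measurableT mY.
by rewrite setTI.
Qed.

Lemma measurable_norm2sq_lt (e : R) : measurable [set w | norm2sq (X w) < e].
Proof. by have [mX _ _] := hX; exact: mX (cvec_borel_norm2sq e). Qed.

Lemma gaussian_norm2sq_small (eta q : R) : 0 < eta -> q <= 1 ->
  (normal_prob 0 sigma [set x : R | (x ^+ 2 < eta)%R] <= q%:E)%E ->
  (Pr [set w | (norm2sq (X w) < n%:R * eta)%R] <= ((4 * q) ^+ n)%:E)%E.
Proof.
move=> eta0 q1 hq; have [_ ind law] := hX.
have q0 : 0 <= q by rewrite -lee_fin; apply: le_trans hq; exact: measure_ge0.
have mI : measurable [set x : R | x ^+ 2 < eta].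
  by apply: measurable_sublevel; exact: measurable_funX.
pose E j := (rcoord j \o X) @^-1` [set x : R | x ^+ 2 < eta].
have mE j : measurable (E j).
  by rewrite -[X in measurable X]setTI; exact: measurable_rcoord_comp.
have SE j : preimage_set_system setT (rcoord j \o X) measurable (E j).
  by exists [set x : R | x ^+ 2 < eta] => //; rewrite setTI.
have Eq j : (Pr (E j) <= q%:E)%E by rewrite law.
have [B [mB NB PB]] := probability_many_le n ind SE mE Eq q0 q1.
(* There are [2 * n] real coordinates, so the number of subsets is [4 ^+ n]. *)
have -> : (4 * q) ^+ n = 2 ^+ #|{: 'I_n * bool}| * q ^+ n.
  by rewrite card_prod card_ord card_bool mulnC exprM -exprMn; congr (_ ^+ _); ring.
apply: le_trans PB; apply: le_measure; rewrite ?inE//.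
  exact: measurable_norm2sq_lt.
(* If fewer than [n] coordinates had square below [eta], at least [n] would have square at least
   [eta], forcing the squared norm up to [n%:R * eta]. *)
move=> w /= wn; apply: NB; rewrite leqNgt; apply/negP => few.
move: wn; apply/negP; rewrite -leNgt norm2sqE.
have := @card_mul_le_sum R _ (fun j => rcoord j (X w) ^+ 2) eta
  (fun j => sqr_ge0 _).
apply: le_trans; rewrite ler_wpM2r ?(ltW eta0)// ler_nat.
have := cardC [pred j | w \in E j].
rewrite card_prod card_ord card_bool muln2 -addnn => cE.
have -> : #|[pred j | eta <= rcoord j (X w) ^+ 2]| =
    #|[predC [pred j | w \in E j]]|.
  apply: eq_card => j; rewrite !inE /E mem_setE /= -leNgt//.
by rewrite -(leq_add2l #|[pred j | w \in E j]|) cE leq_add2r ltnW.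
Qed.

(** Each coordinate contributes the second moment of its normal law, which is finite. *)
Lemma gaussian_norm2sq_lty : (\int[Pr]_w (norm2sq (X w))%:E < +oo)%E.
Proof.
have [_ _ law] := hX.
under eq_integral do rewrite norm2sqE -sumEFin.
rewrite ge0_integral_sum//; last 2 first.
- move=> j; apply/measurable_EFinP; apply: measurable_funX.
  exact: measurable_rcoord_comp.
- by move=> j w _; rewrite lee_fin sqr_ge0.
apply: lte_sum_pinfty => j _.
have -> : (\int[Pr]_w (rcoord j (X w) ^+ 2)%:E =
    \int[normal_prob 0 sigma]_x (x ^+ 2)%:E)%E.
  (* [normal_prob] integrates over [measurableTypeR R], whose display differs
     from the default one of [R]. *)
  have mX : @measurable_fun _ _ T (measurableTypeR R) setT (rcoord j \o X).
    exact: measurable_rcoord_comp.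
  pose mixin := isMeasurableFun.Build _ _ _ _ _ mX.
  pose Xj : {RV Pr >-> measurableTypeR R} := HB.pack (rcoord j \o X) mixin.
  rewrite -(@ge0_integral_distribution _ _ _ _ _ Pr Xj (fun x => (x ^+ 2)%:E)).
  - by apply: eq_measure_integral => A mA _; exact: law.
  - by apply/measurable_EFinP; exact: measurable_funX.
  - by move=> x; rewrite lee_fin sqr_ge0.
by apply: normal_prob_sqr_lty; rewrite sqrtr_eq0 -ltNge invr_gt0.
Qed.

End gaussian_vector.

(** [X] dominates [c] times the indicator of the complement of [B]; finiteness ensures that [fine]
    returns the actual expectation. *)
Lemma expectation_ge (R : realType) (d : measure_display)
    (T : measurableType d) (Pr : probability T R) (X : T -> R) (B : set T)
    (b c : R) :
  (forall w, 0 <= X w) -> ('E_Pr[X] < +oo)%E -> 0 <= c ->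
  measurable B -> (Pr B <= b%:E)%E -> (forall w, ~ B w -> c <= X w) ->
  (1 - b) * c <= fine 'E_Pr[X].
Proof.
move=> X0 Xoo c0 mB Bb cX.
rewrite -lee_fin fineK; last by rewrite ge0_fin_numE// expectation_ge0.
rewrite unlock.
apply: (@le_trans _ _ (\int[Pr]_w (c%:E * (\1_(~` B) w)%:E))%E).
  rewrite ge0_integralZl//; last first.
    by apply/measurable_EFinP; apply: measurable_indic; exact: measurableC.
  rewrite integral_indic//; last exact: measurableC.
  rewrite setIT [X in (_ * X)%E](probability_setC Pr mB) muleC EFinM.
  by rewrite lee_wpmul2r ?lee_fin// EFinB leeB.
apply: ge0_le_integral_nonmeas => w; rewrite -EFinM lee_fin.
  by rewrite mulr_ge0.
by rewrite indicE; have [/set_mem/cX|_] := boolP (w \in _); rewrite ?mulr1 ?mulr0.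
Qed.

(** * Expected minimum rate over all users *)

Section multicast.
Context {R : realType} {d : measure_display} {T : measurableType d}.
Variables (Pr : probability T R) (K L n : nat) (P eta q : R).
Variable H : 'I_K -> 'I_L -> T -> 'rV[R[i]]_n.
Hypotheses (hH : iid_rayleigh Pr H) (n0 : (0 < n)%N).
Hypotheses (P0 : 0 < P) (eta0 : 0 < eta) (q1 : 4 * q <= 1) (q0 : 0 <= q).
Hypothesis hq :
  (normal_prob 0 (Num.sqrt 2^-1 : R) [set x : R | (x ^+ 2 < eta)%R] <= q%:E)%E.

Lemma independent_subchannels k :
  mutually_independent Pr (fun l => preimage_set_system setT (H k l)
    (@cvec_borel R n)).
Proof.
move=> J A SA; have [_ ind] := hH.
(* Joint independence is applied to the pairs with first component [k]. *)
have := ind [set (k, l) | l in J]%SET (fun kl => A kl.2).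
rewrite big_imset/=; last by move=> ? ? _ _ [].
move=> <-; last by move=> _ /imsetP[l lJ ->]; exact: SA.
congr (Pr _); apply/seteqP; split => w wA.
  by move=> _ /imsetP[l lJ ->]; exact: wA.
by move=> l lJ; apply: (wA (k, l)); exact: imset_f.
Qed.

Lemma snr_ge (h : 'rV[R[i]]_n) : n%:R * eta <= norm2sq h -> P * eta <= snr P h.
Proof.
move=> h_ge; rewrite /snr.
have -> : P * eta = P / n%:R * (n%:R * eta).
  by field; rewrite pnatr_eq0 -lt0n.
by rewrite ler_wpM2l// divr_ge0// ltW.
Qed.

Lemma snr_ge0 (h : 'rV[R[i]]_n) : 0 <= snr P h.
Proof. by rewrite mulr_ge0 ?norm2sq_ge0// divr_ge0// ltW. Qed.

(** Second use of the counting estimate, now over sub-channels, with events of probability at most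
    [(4 * q) ^+ n]. *)
Lemma many_bad_subchannels_le k : exists B : set T, [/\ measurable B,
  (forall w, (uphalf L <= #|[pred l | (norm2sq (H k l w) < n%:R * eta)%R]|)%N ->
    B w) & (Pr B <= ((16 * q) ^+ (n * uphalf L))%:E)%E].
Proof.
have [hG _] := hH.
pose E l := [set w | norm2sq (H k l w) < n%:R * eta].
have SE l : preimage_set_system setT (H k l) (@cvec_borel R n) (E l).
  exists [set v | @norm2sq R n v < n%:R * eta]; first exact: cvec_borel_norm2sq.
  by rewrite setTI.
have mE l : measurable (E l) by exact: measurable_norm2sq_lt (hG k l) _.
have EE l : (Pr (E l) <= ((4 * q) ^+ n)%:E)%E.
  apply: (gaussian_norm2sq_small (hG k l) eta0 _ hq).
  by apply: le_trans q1; rewrite ler_peMl ?ler1n.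
have q40 : 0 <= 4 * q by rewrite mulr_ge0.
have [B [mB NB PB]] := probability_many_le (uphalf L) (@independent_subchannels k)
  SE mE EE (exprn_ge0 n q40) (exprn_ile1 n q40 q1).
exists B; split => //.
  move=> w Lw; apply: NB; rewrite (leq_trans Lw)//; apply: eq_leq.
  by apply: eq_card => l; rewrite !inE mem_setE.
apply: (le_trans PB); rewrite lee_fin card_ord -exprM.
(* The count [2 ^+ L] is at most [4 ^+ (n * uphalf L)] as [n] is positive, so it is absorbed by
   replacing [4 * q] with [16 * q]. *)
have -> : 16 * q = 2 ^+ 2 * (4 * q) by ring.
rewrite [leRHS]exprMn -exprM ler_wpM2r ?exprn_ge0// ler_weXn2l ?ler1n//.
rewrite (@leq_trans (2 * uphalf L))//.
  lia.
by rewrite leq_mul2l/= leq_pmull.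
Qed.

Lemma mean_rate_ge k w :
  (#|[pred l | (norm2sq (H k l w) < n%:R * eta)%R]| < uphalf L)%N ->
  ln (1 + P * eta) / 2 <= 1 / L%:R * \sum_(l < L) ln (1 + snr P (H k l w)).
Proof.
set bad := [pred l | _] => few.
(* [uphalf 0] is [0], so the strict bound excludes [L = 0]. *)
have L0 : (0 < L)%N by move: (leq_ltn_trans (leq0n _) few); lia.
have Pe : 0 < P * eta by rewrite mulr_gt0.
have ln0 : 0 <= ln (1 + P * eta) by rewrite ln_ge0// lerDl ltW.
have lnsnr0 l : 0 <= ln (1 + snr P (H k l w)) by rewrite ln_ge0// lerDl snr_ge0.
have := card_mul_le_sum (ln (1 + P * eta)) lnsnr0.
set good := [pred l | _ <= _] => sum_ge.
(* Every sub-channel that is not bad is good, and fewer than [uphalf L] are bad, so at least half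
   are good. *)
have LG : (L <= 2 * #|good|)%N.
  have : (L - #|bad| <= #|good|)%N.
    rewrite -{1}(card_ord L) -(cardC bad) addKn.
    apply: subset_leq_card; apply/fintype.subsetP => l.
    rewrite !inE -leNgt => /snr_ge sl.
    by rewrite ler_ln ?posrE ?ltr_pwDl// ?lerD2l// ?snr_ge0// ltW.
  by move: few; lia.
rewrite mul1r ler_pdivlMl ?ltr0n//.
apply: le_trans sum_ge.
have -> : L%:R * (ln (1 + P * eta) / 2) = L%:R / 2 * ln (1 + P * eta) by ring.
by rewrite ler_wpM2r// ler_pdivrMr// mulrC -natrM ler_nat.
Qed.

(** The minimum is at most the rate of one fixed user, and [ln (1 + x) <= x] bounds that rate by a
    sum of SNRs, whose expectations are finite. *)
Lemma expectation_min_user_lty : (0 < K)%N -> (0 < L)%N ->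
  ('E_Pr[(fun w => min_user (fun k =>
    1 / L%:R * \sum_(l < L) ln (1 + snr P (H k l w))))%R] < +oo)%E.
Proof.
move=> K0 L0; have [hG _] := hH; pose k0 := Ordinal K0; rewrite unlock.
have lnsnr0 k l w : 0 <= ln (1 + snr P (H k l w)).
  by rewrite ln_ge0// lerDl snr_ge0.
have Pn0 : 0 <= P / n%:R by rewrite divr_ge0// ltW.
have mN l : measurable_fun setT (fun w => (norm2sq (H k0 l w))%:E).
  apply/measurable_EFinP; under eq_fun do rewrite norm2sqE.
  apply: measurable_sum => j; apply: measurable_funX.
  exact: (measurable_rcoord_comp (hG k0 l)).
apply: (@le_lt_trans _ _ (\int[Pr]_w (\sum_(l < L)
    ((P / n%:R)%:E * (norm2sq (H k0 l w))%:E)))%E).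
  apply: ge0_le_integral_nonmeas => w.
    rewrite lee_fin; apply: le_min_user => // k.
    by rewrite mulr_ge0 ?sumr_ge0// divr_ge0.
  under eq_bigr do rewrite -EFinM.
  rewrite sumEFin lee_fin; apply: (le_trans (min_user_le _ k0)).
  rewrite mul1r ler_pdivrMl ?ltr0n//.
  apply: (@le_trans _ _ (\sum_(l < L) snr P (H k0 l w))).
    apply: ler_sum => l _; apply: le_ln1Dx.
    by rewrite (lt_le_trans (ltrN10 _))// snr_ge0.
  rewrite ler_peMl ?ler1n// sumr_ge0// => l _; exact: snr_ge0.
rewrite ge0_integral_sum//; last 2 first.
- by move=> l; apply: emeasurable_funM.
- by move=> l w _; rewrite mule_ge0 ?lee_fin// norm2sq_ge0.
apply: lte_sum_pinfty => l _.
rewrite ge0_integralZl//; last by move=> w _; rewrite lee_fin norm2sq_ge0.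
by rewrite lte_mul_pinfty// (gaussian_norm2sq_lty (hG k0 l)).
Qed.

(** The exceptional set is the union of the sets [B k]; outside it every user has mean rate at least
    [ln (1 + P * eta) / 2]. *)
Lemma expectation_min_user_ge : (0 < K)%N -> (0 < L)%N ->
  (1 - K%:R * (16 * q) ^+ (n * uphalf L)) * (ln (1 + P * eta) / 2) <=
  fine 'E_Pr[(fun w => min_user (fun k =>
    1 / L%:R * \sum_(l < L) ln (1 + snr P (H k l w))))%R]%E.
Proof.
move=> K0 L0; have /choice[B hB] := many_bad_subchannels_le.
have mB k : measurable (B k) by have [] := hB k.
have lnsnr0 k l w : 0 <= ln (1 + snr P (H k l w)).
  by rewrite ln_ge0// lerDl snr_ge0.
apply: (@expectation_ge _ _ _ _ _ (\big[setU/set0]_k B k)).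
- move=> w; apply: le_min_user => // k.
  by rewrite mulr_ge0 ?sumr_ge0// divr_ge0.
- exact: expectation_min_user_lty.
- by rewrite divr_ge0// ln_ge0// lerDl mulr_ge0// ltW.
- exact: measurable_bigsetU_fin.
- apply: (le_trans (probability_bigsetU_le Pr (fun k (_ : true) => mB k))).
  apply: (@le_trans _ _ (\sum_(k < K) ((16 * q) ^+ (n * uphalf L))%:E)%E).
    by apply: lee_sum => k _; have [] := hB k.
  by rewrite sumEFin lee_fin sumr_const card_ord -[leLHS]mulr_natl.
- move=> w nB; apply: le_min_user => // k; apply: mean_rate_ge.
  rewrite ltnNge; apply/negP => many; apply: nB.
  by rewrite (bigD1 k)//=; left; have [_ + _] := hB k; exact.
Qed.
End multicast.

(** * Threshold-based user selection *)

Section selection.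
Context {R : realType} {d : measure_display} {T : measurableType d}.
Variables (Pr : probability T R) (K n : nat) (P m eta : R).
Variable H : 'I_K -> T -> 'rV[R[i]]_n.
Hypotheses (hH : forall k, std_complex_gaussian Pr (H k)) (n0 : (0 < n)%N).
Hypotheses (P0 : 0 < P) (eta0 : 0 < eta) (m0 : 0 < m) (m1 : m < 1).
Hypothesis small : forall k,
  (Pr [set w | (norm2sq (H k w) < n%:R * eta)%R] <= 2^-1%:E)%E.

(** When someone is selected, the denominator [1 - (1 - m) ^+ Ks] lies between [m] and [1]. The
    upper bound makes the integrand at least [c * Ks]; the lower one keeps it bounded, so its
    expectation is finite. *)
Lemma selection_rate_ge :
  m / (1 - m) * ln (1 + P * eta) / 2 * K%:R <= selection_rate P m (P * eta) Pr H.
Proof.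
set c := m / (1 - m) * ln (1 + P * eta).
have ln0 : 0 <= ln (1 + P * eta) by rewrite ln_ge0// lerDl mulr_ge0// ltW.
have mm0 : 0 <= m / (1 - m) by rewrite divr_ge0 ?subr_ge0// ltW.
have c0 : 0 <= c by rewrite mulr_ge0.
rewrite /selection_rate; set G := fun w : T => _.
pose Ks := nb_selected P (P * eta) H.
have GE w : Ks w != 0%N -> G w = c * (Ks w)%:R / (1 - (1 - m) ^+ Ks w).
  by move=> K0; rewrite /G -/(Ks w) (negbTE K0) /c; ring.
have D1 w : 1 - (1 - m) ^+ Ks w <= 1.
  by rewrite lerBlDr lerDl exprn_ge0// subr_ge0 ltW.
have Dm w : Ks w != 0%N -> m <= 1 - (1 - m) ^+ Ks w.
  rewrite -lt0n => K0; rewrite lerBrDl -lerBrDr.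
  by rewrite -[leRHS]expr1 ler_wiXn2l ?subr_ge0 ?(ltW m1)// gerBl (ltW m0).
have G_ge w : c * (Ks w)%:R <= G w.
  have [K0|K0] := eqVneq (Ks w) 0%N.
    by rewrite /G -/(Ks w) K0 eqxx mulr0.
  have D0 := lt_le_trans m0 (Dm w K0).
  by rewrite GE// ler_pdivlMr// ler_piMr// mulr_ge0.
have G_le w : G w <= c * K%:R / m.
  have KsK : (Ks w <= K)%N by rewrite -[leqRHS](card_ord K) max_card.
  have [K0|K0] := eqVneq (Ks w) 0%N.
    rewrite /G -/(Ks w) K0 eqxx.
    exact: divr_ge0 (mulr_ge0 c0 (ler0n _ _)) (ltW m0).
  have D0 := lt_le_trans m0 (Dm w K0).
  rewrite GE//; apply: ler_pM.
  - exact: mulr_ge0.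
  - by rewrite invr_ge0 ltW.
  - by rewrite ler_wpM2l// ler_nat.
  - by rewrite lef_pV2 ?posrE// Dm.
have G0 w : 0 <= G w by rewrite (le_trans _ (G_ge w))// mulr_ge0.
pose A k := [set w | norm2sq (H k w) < n%:R * eta].
have mA k : measurable (A k) by exact: measurable_norm2sq_lt (hH k) _.
have Goo : ('E_Pr[G] < +oo)%E.
  apply: (@le_lt_trans _ _ (\int[Pr]_w (cst (c * K%:R / m)%:E w))%E).
    by rewrite unlock; apply: ge0_le_integral_nonmeas => w; rewrite lee_fin.
  by rewrite integral_cst// [X in (_ * X)%E]probability_setT mule1 ltry.
rewrite -lee_fin fineK; last by rewrite ge0_fin_numE// expectation_ge0.
(* The number of selected users is at least the sum of the indicators of the complements of [A k],
   each of expectation at least one half. *)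
apply: (@le_trans _ _ (\int[Pr]_w (\sum_(k < K) (c%:E * (\1_(~` A k) w)%:E)))%E).
  have mI k : measurable_fun setT (fun w => (\1_(~` A k) w)%:E : \bar R).
    by apply/measurable_EFinP; apply: measurable_indic; exact: measurableC.
  rewrite ge0_integral_sum//; last 2 first.
  - by move=> k; apply: emeasurable_funM.
  - by move=> k w _; rewrite mule_ge0// lee_fin.
  apply: (@le_trans _ _ (\sum_(k < K) (c / 2)%:E)%E).
    by rewrite sumEFin lee_fin sumr_const card_ord mulr_natr.
  apply: lee_sum => k _; rewrite ge0_integralZl//.
  rewrite integral_indic//; last exact: measurableC.
  rewrite setIT [X in (_ * X)%E](probability_setC Pr (mA k)) EFinM.
  rewrite lee_wpmul2l ?lee_fin//.
  have -> : (2^-1 : R) = 1 - 2^-1 by field.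
  by rewrite EFinB leeB// small.
rewrite expectation.unlock; apply: ge0_le_integral_nonmeas => w.
  by apply: sume_ge0 => k _; rewrite mule_ge0// lee_fin.
under eq_bigr do rewrite -EFinM.
rewrite sumEFin lee_fin -mulr_sumr; apply: le_trans (G_ge w).
rewrite ler_wpM2l// /Ks /nb_selected -sum1_card natr_sum [leRHS]big_mkcond/=.
apply: ler_sum => k _; rewrite indicE inE.
have [/set_mem/negP|//] := boolP (w \in ~` A k); last by case: ifP.
by rewrite -leNgt => /(snr_ge n0 P0) ->.
Qed.
End selection.

(** * Transmission counts and final assembly *)

Lemma T_centralized_bounds (R : realType) (m : R) (K : nat) :
  0 < m -> m < 1 -> (0 < K)%N ->
  0 < T_centralized m K <= (1 - m) / m.
Proof.
move=> m0 m1 K0; rewrite /T_centralized div1r.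
have Km : 0 < 1 / K%:R + m by rewrite ltr_wpDl// divr_ge0.
rewrite mulr_gt0 ?subr_gt0 ?invr_gt0//= ler_wpM2l ?subr_ge0 ?(ltW m1)//.
by rewrite lef_pV2 ?posrE// lerDr divr_ge0.
Qed.

Lemma T_decentralized_bounds (R : realType) (m : R) (K : nat) :
  0 < m -> m < 1 -> (0 < K)%N ->
  0 < T_decentralized m K <= (1 - m) / m.
Proof.
move=> m0 m1 K0; rewrite /T_decentralized.
have m'0 : 0 <= 1 - m by rewrite subr_ge0 ltW.
have mK : (1 - m) ^+ K < 1 by rewrite exprn_ilt1 -?lt0n// gtrBl.
rewrite mulr_gt0 ?divr_gt0 ?subr_gt0//= ler_wpM2l//.
by rewrite ler_pdivrMr// mulVf ?gt_eqF// gerBl exprn_ge0.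
Qed.

(** Only the range of [t] matters, so both caching schemes are handled at once: [K%:R / t] is at
    least [K%:R * m / (1 - m)]. *)
Lemma multicast_rate_ge (R : realType) (P t m c : R) (d : measure_display)
    (T : measurableType d) (Pr : probability T R) (K L n : nat)
    (H : 'I_K -> 'I_L -> T -> 'rV[R[i]]_n) :
  0 < m -> m < 1 -> 0 < t <= (1 - m) / m -> 0 <= c ->
  c <= fine 'E_Pr[(fun w => min_user (fun k =>
    1 / L%:R * \sum_(l < L) ln (1 + snr P (H k l w))))%R]%E ->
  c * m / (1 - m) * K%:R <= multicast_rate P t Pr H.
Proof.
move=> m0 m1 /andP[t0 tm] c0 cE; rewrite /multicast_rate.
have -> : c * m / (1 - m) * K%:R = K%:R * ((1 - m) / m)^-1 * c.
  by rewrite invf_div; ring.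
have m'0 : 0 < 1 - m by rewrite subr_gt0.
apply: ler_pM => //.
  by rewrite mulr_ge0// invr_ge0 divr_ge0// ltW.
by rewrite ler_wpM2l// lef_pV2 ?posrE// divr_gt0.
Qed.

(* [n * uphalf L >= L n / 2], so a per-coordinate probability below
   [expR (-4) / 16] yields a union bound of order [K * expR (- 2 ln K)]. *)
Lemma union_bound_small (R : realType) (q c0 : R) (K L n : nat) :
  0 <= q -> 16 * q <= expR (- 4) -> (0 < K)%N ->
  ln K%:R + c0 <= (L * n)%:R -> 2 * expR (- 2 * c0) <= K%:R ->
  K%:R * (16 * q) ^+ (n * uphalf L) <= 2^-1.
Proof.
move=> q0 q16 K0 cK Kbig; have KR : 0 < K%:R :> R by rewrite ltr0n.
have : (16 * q) ^+ (n * uphalf L) <= expR (- 2 * (ln K%:R + c0)).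
  apply: (@le_trans _ _ (expR (- 4) ^+ (n * uphalf L))).
    by rewrite lerXn2r// nnegrE ?expR_ge0// mulr_ge0.
  (* The exponent is [- 4 * (n * uphalf L)], at most [- 2 * (L * n)] and hence at most
     [- 2 * (ln K + c0)]. *)
  rewrite -expRM_natl ler_expR.
  have : (L * n)%:R <= 2 * (n * uphalf L)%:R :> R.
    by rewrite -natrM ler_nat; nia.
  by move: cK; lra.
have -> : expR (- 2 * (ln K%:R + c0)) = expR (- 2 * c0) / K%:R ^+ 2.
  rewrite mulrDr addrC expRD; congr (_ * _).
  by rewrite mulNr expRN expRM_natl lnK.
move=> /(ler_wpM2l (ltW KR)) /le_trans; apply.
have -> : K%:R * (expR (- 2 * c0) / K%:R ^+ 2) = expR (- 2 * c0) / K%:R.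
  by field; rewrite gt_eqF.
by rewrite ler_pdivrMr// ler_pdivlMl.
Qed.

Theorem theorem1 (R : realType) (P m : R)
    (hP : 0 < P) (hm0 : 0 < m) (hm1 : m < 1) :
  (forall (n L : nat -> nat),
    (forall K, (1 <= n K)%N) -> (forall K, (1 <= L K)%N) ->
    (exists c0 : R, \forall K \near \oo, ln K%:R + c0 <= (L K * n K)%:R) ->
    forall (d : nat -> measure_display) (T : forall K, measurableType (d K))
      (Pr : forall K, probability (T K) R)
      (H : forall K, 'I_K -> 'I_(L K) -> T K -> 'rV[R[i]]_(n K)),
      (forall K, iid_rayleigh (Pr K) (H K)) ->
      linear_scaling
        (fun K => multicast_rate P (T_centralized m K) (Pr K) (H K)) /\
      linear_scaling
        (fun K => multicast_rate P (T_decentralized m K) (Pr K) (H K)))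
  /\
  (forall n : nat, (1 <= n)%N ->
    exists s : R, 0 < s /\
    forall (d : nat -> measure_display) (T : forall K, measurableType (d K))
      (Pr : forall K, probability (T K) R)
      (H : forall K, 'I_K -> 'I_1 -> T K -> 'rV[R[i]]_n),
      (forall K, iid_rayleigh (Pr K) (H K)) ->
      linear_scaling
        (fun K => selection_rate P m s (Pr K) (fun k => H K k ord0))).
Proof.
have s0 : Num.sqrt 2^-1 != 0 :> R by rewrite sqrtr_eq0 -ltNge invr_gt0.
split.
- move=> n L n1 L1 [c0 cLn] d T Pr H hH.
  pose q : R := expR (- 4) / 16.
  have q0 : 0 < q by rewrite divr_gt0 ?expR_gt0.
  have [eta eta0 etaq] := normal_prob_sqr_lt_small s0 q0.
  have e1 : expR (- 4) <= 1 :> R by rewrite expR_le1 oppr_le0.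
  have q1 : 4 * q <= 1 by rewrite /q; lra.
  have q16 : 16 * q <= expR (- 4) by rewrite /q; lra.
  have Pe : 0 < P * eta by rewrite mulr_gt0.
  (* The factor [2^-1] bounds from below the probability that no user is bad, for large [K]; the
     other factor is the rate then guaranteed. *)
  pose c := 2^-1 * (ln (1 + P * eta) / 2).
  have c0' : 0 < c by rewrite mulr_gt0 ?invr_gt0// divr_gt0// ln_gt0// ltrDl.
  have m'0 : 0 < 1 - m by rewrite subr_gt0.
  have cm0 : 0 < c * m / (1 - m) by rewrite divr_gt0// mulr_gt0.
  have rate t : (forall K, (0 < K)%N -> 0 < t K <= (1 - m) / m) ->
      linear_scaling (fun K => multicast_rate P (t K) (Pr K) (H K)).
    move=> tm; apply: (linear_scaling_ge cm0); near=> K.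
    have K0 : (0 < K)%N by near: K; exact: nbhs_infty_gt.
    apply: multicast_rate_ge => //; [exact: tm|exact: ltW|].
    have := expectation_min_user_ge (hH K) (n1 K) hP eta0 q1 (ltW q0) etaq K0
      (L1 K).
    apply: le_trans; rewrite ler_wpM2r//.
      by rewrite divr_ge0// ln_ge0// lerDl ltW.
    have : K%:R * (16 * q) ^+ (n K * uphalf (L K)) <= 2^-1.
      apply: (@union_bound_small _ _ c0); [exact: ltW|by []|by []| |].
        by near: K.
      by near: K; exact: nbhs_infty_ger.
    lra.
  by split; apply: rate => K K0;
    [exact: T_centralized_bounds|exact: T_decentralized_bounds].
- move=> n n1.
  (* With [q = 1/8], [(4 * q) ^+ n] is at most [1/2] for every [n >= 1]; the resulting threshold is
     fixed before [K] and the channels. *)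
  have q0 : 0 < 8^-1 :> R by rewrite invr_gt0.
  have [eta eta0 etaq] := normal_prob_sqr_lt_small s0 q0.
  have Pe : 0 < P * eta by rewrite mulr_gt0.
  exists (P * eta); split=> // d T Pr H hH.
  have c0 : 0 < m / (1 - m) * ln (1 + P * eta) / 2.
    by rewrite divr_gt0// mulr_gt0 ?divr_gt0 ?subr_gt0// ln_gt0// ltrDl.
  apply: (linear_scaling_ge c0); near=> K.
  have [hG _] := hH K.
  apply: selection_rate_ge => // k.
  have q1 : 8^-1 <= 1 :> R by rewrite invf_le1// ler1n.
  apply: le_trans (gaussian_norm2sq_small (hG k ord0) eta0 q1 etaq) _.
  rewrite lee_fin; have -> : 4 * 8^-1 = 2^-1 :> R by field.
  by rewrite -[leRHS]expr1 ler_wiXn2l ?invr_ge0// invf_le1// ler1n.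
Unshelve. all: by end_near. Qed.
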